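(* In pull-based broadcast scheduling with pages of arbitrary (possibly different) sizes in the sequential model, for every request sequence, the maximum response time of the schedule produced online by $\mathrm{FIFO}$ on a speed-$1$ server is at most $2\rho^*$, where $\rho^*$ is the minimum maximum response time achievable by any offline schedule on a speed-$1$ server. That is, $\mathrm{FIFO}$ is $2$-competitive for minimizing maximum response time.
   Context: Broadcast scheduling: a server holds pages; page $p$ has length $\ell_p>0$, the time a speed-$1$ server needs to transmit it. Requests arrive online; the $i$-th request for page $p$, $J_{p,i}$, arrives at time $a_{p,i}$. When the server transmits page $p$, all outstanding requests for $p$ are satisfied simultaneously. Sequential model: a request for $p$ is satisfied only by a transmission of $p$ that starts (from the beginning of the page) at or after its arrival; a request arriving while $p$ is being transmitted is not satisfied by that transmission. The finish time $f_{p,i}$ is the completion time of the first such transmission, and the response time is $f_{p,i}-a_{p,i}$. The objective is the maximum response time over all requests. Algorithm $\mathrm{FIFO}$: whenever the server is free, it picks the unsatisfied request with the earliest arrival time (ties broken arbitrarily) and non-preemptively broadcasts its page; all requests for that page that arrived before the start of this broadcast are satisfied when it completes. *)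

(* Defs.v *)
From mathcomp Require Import all_boot all_order all_algebra.
From mathcomp Require Import all_classical all_reals all_analysis.
Set Implicit Arguments.
Unset Strict Implicit.
Unset Printing Implicit Defensive.
Import Order.TTheory GRing.Theory Num.Theory.
Local Open Scope classical_set_scope.
Local Open Scope ring_scope.

(* The request J_{p,i} is an element r of [request] with [page_of r = p] and
   [arrival r = a_{p,i}].  Request sequences may be infinite, provided that only
   finitely many requests arrive up to any given time; this always holds for a
   finite sequence, and it ensures that "the earliest unsatisfied request" makes
   sense. *)
Record instance (R : realType) := Instance {
  page : Type;
  len : page -> R;
  len_gt0 : forall p, 0 < len p;
  request : Type;
  page_of : request -> page;
  arrival : request -> R;
  arrival_locally_finite :
    forall t : R, finite_set [set r | arrival r <= t]
}.

(* An arbitrary, possibly preemptive, schedule.  [tx] indexes the transmissions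
   that are carried out to completion, and [current t] is the one (if any) to
   which the server is devoted at time t, so that the server works on at most
   one transmission at a time.  Since the server has speed 1, a transmission of
   p takes a set of times of measure [len p].  Time spent on transmissions that
   are never completed is useless to all requests and counts as idle. *)
Record schedule (R : realType) (I : instance R) := Schedule {
  tx : Type;
  tx_page : tx -> page I;
  current : R -> option tx;
  slot := fun k => [set t | current t = Some k];
  slot_measurable : forall k, measurable (slot k);
  slot_len : forall k, lebesgue_measure (slot k) = (len (tx_page k))%:E;
  slot_lbound : forall k, has_lbound (slot k);
  slot_ubound : forall k, has_ubound (slot k)
}.

Section Schedules.
Context {R : realType} {I : instance R}.
Implicit Types (s : schedule I) (r : request I) (t : R).

(* Slots are nonempty, having positive measure, and bounded: these infima and
   suprema are genuine. *)
Definition tx_start s (k : tx s) : R := inf (slot k).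
Definition tx_finish s (k : tx s) : R := sup (slot k).

(* Sequential model: the transmission must start after the arrival. *)
Definition serves s (k : tx s) r : Prop :=
  tx_page k = page_of r /\ arrival r <= tx_start k.

(* Equal to +oo for a request that is never satisfied. *)
Definition finish_time s r : \bar R :=
  ereal_inf [set (tx_finish k)%:E | k in [set k : tx s | serves k r]].

Definition response_time s r : \bar R := (finish_time s r - (arrival r)%:E)%E.

Definition max_response s : \bar R := ereal_sup (range (response_time s)).

Definition unsatisfied s t r : Prop :=
  arrival r <= t /\ ~ (exists k : tx s, serves k r /\ tx_finish k <= t).

Definition nonpreemptive s : Prop :=
  forall k : tx s, slot k = `[tx_start k, tx_finish k[%classic.

Definition earliest_unsatisfied s t r : Prop :=
  unsatisfied s t r /\
  (forall r', unsatisfied s t r' -> arrival r <= arrival r').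

(* Slots being closed on the left, a server that becomes free at time t and
   immediately starts a broadcast is not idle at time t.  The relation leaves
   ties unresolved: every tie-breaking rule yields FIFO schedules. *)
Definition is_FIFO s : Prop :=
  [/\ nonpreemptive s,
      (forall t, current s t = None -> forall r, ~ unsatisfied s t r) &
      (forall k : tx s, exists r,
         earliest_unsatisfied s (tx_start k) r /\ tx_page k = page_of r)].

End Schedules.

(* The offline optimum rho^*. *)
Definition opt_response (R : realType) (I : instance R) : \bar R :=
  ereal_inf (range (@max_response R I)).

(* Main.v *)
(* Call a FIFO transmission late if it ends more than [rho] after the arrival of
   the request that triggered it. Suppose that a request arriving at [a] is not
   satisfied by [T = a + 2 rho], and let [t1] be the last time up to [T] at which
   FIFO idles or works on a transmission that is not late. In both cases the
   triggers of the (late) transmissions carried out after [t1] arrive in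
   [[t1 - rho, a]], because triggers arrive in the order in which they are
   served. The optimum cannot merge two of them for the same page, so it performs
   the same transmissions, all within [[t1 - rho, a + rho]], of length [T - t1].
   But FIFO spends more than [T - t1] on them, as it is still busy at [T]. *)
Require Import Defs.
From mathcomp Require Import all_boot all_order all_algebra.
From mathcomp Require Import all_classical all_reals all_analysis.
From mathcomp Require Import lra.
Set Implicit Arguments.
Unset Strict Implicit.
Unset Printing Implicit Defensive.
Import Order.TTheory GRing.Theory Num.Theory.

Section BroadcastFIFO.
Local Open Scope classical_set_scope.
Local Open Scope ring_scope.

(** Gives a time before all arrivals up to a given time, when no FIFO transmission can be running
    yet. *)
Lemma finite_set_lt_lbound (R : realType) (A : set R) :
  finite_set A -> exists b, forall x, A x -> b < x.
Proof.
move=> /finite_seqP[r ->]; elim: r => [|x r [b hb]]; first by exists 0.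
exists (Num.min b (x - 1)) => y /=; rewrite inE gt_min => /orP[/eqP->|/hb->//].
by rewrite gtrBl ltr01 orbT.
Qed.

Context {R : realType} {I : instance R}.
Implicit Types (s : schedule I) (r : request I).

(** * Slots of transmissions *)

Lemma slot_sub_itv s (k : tx s) : slot k `<=` `[tx_start k, tx_finish k].
Proof.
move=> t kt /=; rewrite in_itv /= /tx_start /tx_finish.
by rewrite ge_inf ?ub_le_sup//; [exact: slot_ubound|exact: slot_lbound].
Qed.

Lemma len_le_finishB s (k : tx s) :
  len (tx_page k) <= tx_finish k - tx_start k.
Proof.
have : (lebesgue_measure (slot k) <=
    lebesgue_measure (`[tx_start k, tx_finish k] : set R))%E.
  apply: le_measure; rewrite ?inE//; first exact: slot_measurable.
  exact: slot_sub_itv.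
rewrite slot_len lebesgue_measure_itv/=; case: ifP => // _.
by rewrite lee_fin leNgt len_gt0.
Qed.

Lemma tx_start_lt_finish s (k : tx s) : tx_start k < tx_finish k.
Proof.
by rewrite -subr_gt0; apply: lt_le_trans (len_le_finishB k); exact: len_gt0.
Qed.

Lemma nonpreemptive_len s (k : tx s) : nonpreemptive s ->
  tx_finish k = tx_start k + len (tx_page k).
Proof.
move=> nps; have := slot_len k.
rewrite nps lebesgue_measure_itv/= lte_fin tx_start_lt_finish => -[<-].
by rewrite subrKC.
Qed.

Lemma slot_start s (k : tx s) : nonpreemptive s -> slot k (tx_start k).
Proof. by move=> ->; rewrite /= in_itv /= lexx tx_start_lt_finish. Qed.

Lemma slot_inj s (k k' : tx s) t : slot k t -> slot k' t -> k = k'.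
Proof. by rewrite /slot/= => -> []. Qed.

Lemma nonpreemptive_disjoint s (k k' : tx s) : nonpreemptive s ->
  tx_start k <= tx_start k' -> k <> k' -> tx_finish k <= tx_start k'.
Proof.
move=> nps le_kk' nkk'; rewrite leNgt; apply/negP => lt_k'k; apply: nkk'.
apply: (@slot_inj _ _ _ (tx_start k')); last exact: slot_start.
by rewrite nps /= in_itv /= le_kk'.
Qed.

Lemma unsatisfied_anti s r t t' : t' <= t -> arrival r <= t' ->
  unsatisfied s t r -> unsatisfied s t' r.
Proof.
move=> t't rt' [_ nr]; split=> // -[k [kr kt']]; apply: nr.
by exists k; split=> //; exact: le_trans t't.
Qed.

(* [x k] is the request that triggered the transmission [k] of the FIFO
   schedule [s]; [o] is a schedule of maximum response time at most [rho],
   in which [y r] is a transmission that serves [r] in time. *)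
Section FIFO.
Context (s o : schedule I) (x : tx s -> request I) (y : request I -> tx o).
Context (rho : R).
Hypothesis nps : nonpreemptive s.
Hypothesis idle : forall t, current s t = None -> forall r, ~ unsatisfied s t r.
Hypothesis xE : forall k, earliest_unsatisfied s (tx_start k) (x k) /\
  tx_page k = page_of (x k).
Hypothesis yE : forall r, serves (y r) r /\ tx_finish (y r) <= arrival r + rho.

Let late : set (tx s) := [set k | arrival (x k) + rho < tx_finish k].

(** * Triggers of FIFO transmissions *)

Lemma trigger_arrival (k : tx s) : arrival (x k) <= tx_start k.
Proof. by have [[[]]] := xE k. Qed.

Lemma trigger_served (k : tx s) : serves k (x k).
Proof. by split; [have [] := xE k|exact: trigger_arrival]. Qed.

(** By the time a second transmission starts, the first has finished and satisfied their common
    trigger. *)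
Lemma trigger_inj : injective x.
Proof.
suff wlg k k' : tx_start k <= tx_start k' -> x k = x k' -> k = k'.
  move=> k k' xkk'; have [/wlg->//|/ltW/wlg] := leP (tx_start k) (tx_start k').
  by move=> <-.
move=> le_kk' xkk'; apply: contrapT => nkk'.
have [[[_ nx] _] _] := xE k'; apply: nx; exists k; split.
  by rewrite -xkk'; exact: trigger_served.
exact: nonpreemptive_disjoint.
Qed.

Lemma finite_started T : finite_set [set k : tx s | tx_start k <= T].
Proof.
apply: (@sub_finite_set _ _ (x @^-1` [set r | arrival r <= T])).
  by move=> k /= kT; exact: le_trans (trigger_arrival k) kT.
apply: finite_preimage; last exact: arrival_locally_finite.
by move=> ? ? _ _; exact: trigger_inj.
Qed.

(** Either the trigger of [k'] is already outstanding when [k] starts, and FIFO's choice decides, or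
    it arrives only after that. *)
Lemma trigger_mono (k k' : tx s) : tx_start k <= tx_start k' ->
  arrival (x k) <= arrival (x k').
Proof.
move=> kk'; have [[_ emin] _] := xE k.
have [le_x|/ltW le_x] := leP (arrival (x k')) (tx_start k).
  by apply: emin; apply: unsatisfied_anti kk' le_x _; have [[]] := xE k'.
exact: le_trans (trigger_arrival k) le_x.
Qed.

Lemma trigger_after_idle (k : tx s) t : current s t = None ->
  t <= tx_start k -> t < arrival (x k).
Proof.
move=> t0 tk; rewrite ltNge; apply/negP => xt; apply: (idle t0).
by apply: unsatisfied_anti tk xt _; have [[]] := xE k.
Qed.

(* If [o] merged the triggers of [k] and of a later [k'], it would only start
   after [k] did, hence finish after [k] does: too late for the trigger of
   [k]. *)
Lemma late_not_merged (k k' : tx s) : late k -> late k' ->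
  y (x k) = y (x k') -> k = k'.
Proof.
suff wlg (h h' : tx s) : tx_start h <= tx_start h' -> late h ->
    y (x h) = y (x h') -> h = h'.
  move=> lk lk' ykk'; have [le_kk'|/ltW le_k'k] :=
    leP (tx_start k) (tx_start k'); first exact: wlg.
  by apply/esym/wlg.
move=> le_hh' lh yhh'; apply: contrapT => nhh'.
have fin_h : tx_finish h <= tx_start h' by exact: nonpreemptive_disjoint.
have [[py ay] fy] := yE (x h); have [[py' ay'] _] := yE (x h').
have ph : tx_page h = page_of (x h) by have [] := xE h.
(* Otherwise [h] would have served this trigger before [h'] started. *)
have lt_hx : tx_start h < arrival (x h').
  rewrite ltNge; apply/negP => le_xh.
  have [[[_ nx] _] _] := xE h'; apply: nx; exists h; split => //; split => //.
  by rewrite ph -py yhh' py'.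
have := len_le_finishB (y (x h)); rewrite py -ph.
rewrite -yhh' in ay'; rewrite /late/= (nonpreemptive_len _ nps) in lh.
lra.
Qed.

Lemma rho_gt0 r : 0 < rho.
Proof.
have [[_ ay] fy] := yE r; have := tx_start_lt_finish (y r).
lra.
Qed.

(** * Comparison of the work done by FIFO and by [o] *)

Lemma FIFO_served r : exists k : tx s, serves k r /\
  tx_finish k <= arrival r + 2 * rho.
Proof.
apply: contrapT => nserv; have rho0 := rho_gt0 r.
set a := arrival r in nserv *; set T := a + 2 * rho in nserv *.
have unsat t : a <= t -> t <= T -> unsatisfied s t r.
  move=> at_ tT; split=> // -[k [kr kt]]; apply: nserv.
  by exists k; split => //; exact: le_trans tT.
(* [r] is outstanding throughout [[a, T]], so FIFO prefers no later request to it. *)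
have trig_le k : tx_start k <= T -> arrival (x k) <= a.
  move=> kT; have [ak|/ltW ka] := leP a (tx_start k).
    by have [[_ emin] _] := xE k; apply/emin/unsat.
  exact: le_trans (trigger_arrival k) ka.
have [kT curT] : exists kT, current s T = Some kT.
  case curT: (current s T) => [kT|]; first by exists kT.
  by case: (idle curT (unsat T _ _)) => //; rewrite /T; lra.
have slotP k t : current s t = Some k -> tx_start k <= t < tx_finish k.
  by move=> tk; have : slot k t by []; rewrite nps /= in_itv.
have /andP[kT1 kT2] := slotP _ _ curT.
have lkT : late kT.
  by rewrite /late /=; have := trig_le _ kT1; rewrite /T in kT2; lra.
(* The supremum [t1] of [G] need not belong to [G], so bounds on [t1] are proved for every [t] in
   [G] first. *)
pose G : set R := [set t |
    t <= T /\ forall k, current s t = Some k -> ~ late k].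
have GT : ubound G T by move=> t [].
have supG : has_sup G.
  split; last by exists T.
  have [b hb] := finite_set_lt_lbound
    (finite_image (@arrival R I) (@arrival_locally_finite R I T)).
  exists (Num.min b T); split; first by rewrite ge_min lexx orbT.
  move=> k /slotP/andP[]; rewrite le_min => /andP[kb kT'] _ _.
  have /hb : (@arrival R I @` [set r | arrival r <= T]) (arrival (x k)).
    by exists (x k) => //=; exact: le_trans (trigger_arrival k) kT'.
  by rewrite ltNge (le_trans (trigger_arrival k) kb).
set t1 := sup G.
have t1T : t1 <= T by apply: ge_sup => //; case: supG.
(* A late slot is an interval disjoint from [G], so it cannot start before [t1] and still be running
   at [t1] or later. *)
have late_after k u : late k -> current s u = Some k -> t1 <= u ->
    t1 <= tx_start k.
  move=> lk uk t1u; apply: ge_sup; first by case: supG.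
  move=> t Gt; rewrite leNgt; apply/negP => kt.
  have tu : t <= u by apply: le_trans t1u; apply: ub_le_sup => //; exists T.
  case: Gt => _ /(_ k); apply => //.
  suff : slot k t by [].
  rewrite nps /= in_itv /= (ltW kt) /=.
  by have /andP[_] := slotP _ _ uk; exact: le_lt_trans.
(* [{classic tx s}] supplies the choice structure required by finite additivity of the measure. *)
pose K : set {classic tx s} :=
  [set k : tx s | [/\ late k, tx_start k <= T & t1 <= tx_start k]].
have finK : finite_set K.
  by apply: sub_finite_set (finite_started T) => k [].
have trig_ge k : K k -> t1 - rho <= arrival (x k).
  move=> [lk kT' t1k]; rewrite lerBlDr; apply: ge_sup; first by case: supG.
  move=> t Gt; have tk : t <= tx_start k.
    by apply: le_trans t1k; apply: ub_le_sup => //; exists T.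
  (* If the server idles at [t], the trigger of [k] arrives after [t]. Otherwise [g] is not late and
     runs past [t], so its trigger arrives after [t - rho], and that of [k] no earlier. *)
  case curt: (current s t) => [g|]; last first.
    by have := trigger_after_idle curt tk; lra.
  have /andP[gt tg] := slotP _ _ curt.
  case: Gt => _ /(_ g curt) /negP; rewrite -leNgt => fg.
  have := trigger_mono (le_trans gt tk); lra.
have mo (k : tx o) : measurable (slot k) by exact: slot_measurable.
have ms (k : tx s) : measurable (slot k) by exact: slot_measurable.
have work : lebesgue_measure (\bigcup_(k in K) slot (k : tx s)) =
    lebesgue_measure (\bigcup_(k in K) slot (y (x k))).
  have trivs : trivIset K (fun k => slot (k : tx s)).
    by move=> k k' _ _ [t [kt k't]]; exact: slot_inj kt k't.
  have trivo : trivIset K (fun k => slot (y (x k))).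
    move=> k k' [lk _ _] [lk' _ _] [t [kt k't]].
    by apply: late_not_merged => //; exact: slot_inj kt k't.
  apply: (etrans (measure_fin_bigcup lebesgue_measure finK trivs
    (fun k _ => ms k))).
  apply: (etrans _ (esym (measure_fin_bigcup lebesgue_measure finK trivo
    (fun k _ => mo _)))).
  apply: eq_fsbigr => k _.
  apply: (etrans (slot_len (k : tx s))).
  apply: (etrans _ (esym (slot_len (y (x k))))).
  by have [[-> _] _] := yE (x k); have [_ ->] := xE k.
have lo : (lebesgue_measure (\bigcup_(k in K) slot (k : tx s)) >=
    (tx_finish kT - t1)%:E)%E.
  have -> : (tx_finish kT - t1)%:E =
      lebesgue_measure (`]t1, tx_finish kT[ : set R).
    by rewrite lebesgue_measure_itv/= lte_fin (le_lt_trans t1T kT2).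
  apply: le_measure; rewrite ?inE//; first by
    apply: fin_bigcup_measurable finK _ => k _; exact: slot_measurable.
  move=> u /=; rewrite in_itv/= => /andP[t1u ukT].
  (* Up to [T], times after [t1] lie outside [G]; beyond [T], [kT] is still running. *)
  have [uT|Tu] := leP u T.
    have : ~ G u.
      by move=> Gu; have := ub_le_sup supG.2 Gu; rewrite leNgt t1u.
    move=> /not_andP[//|/existsNP[k /not_implyP[uk /contrapT lk]]].
    exists k => //; split => //; last exact: late_after lk uk (ltW t1u).
    by have /andP[/le_trans->] := slotP _ _ uk.
  exists kT; first by split => //; exact: late_after lkT curT t1T.
  by rewrite nps /= in_itv /= ukT andbT (le_trans kT1 (ltW Tu)).
have hi : (lebesgue_measure (\bigcup_(k in K) slot (y (x k))) <=
    (T - t1)%:E)%E.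
  (* [kT] belongs to [K], which makes the interval below nondegenerate. *)
  have /andP[akT kTa] : (t1 - rho <= arrival (x kT) <= a).
    by rewrite trig_ge ?trig_le//; split => //; exact: late_after lkT curT t1T.
  have -> : (T - t1)%:E =
      lebesgue_measure (`[t1 - rho, a + rho] : set R).
    rewrite lebesgue_measure_itv/= lte_fin ifT; last by lra.
    by rewrite -EFinB /T; congr EFin; lra.
  apply: le_measure; rewrite ?inE//; first by
    apply: fin_bigcup_measurable finK _ => k _; exact: slot_measurable.
  move=> u /= [k Kk /slot_sub_itv] /=; rewrite !in_itv /= => /andP[yu uy].
  have [[_ ay] fy] := yE (x k); have := trig_ge _ Kk.
  case: Kk => _ /trig_le xa _ xt; apply/andP; split; lra.
have := le_trans (eq_ind _ (fun m => _ <= m)%E lo _ work) hi.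
rewrite lee_fin; lra.
Qed.

End FIFO.

(* The bound is stated with [rho] above the maximum response time because the
   infimum in [finish_time] is not known to be attained. *)
Lemma max_response_lt s (rho : R) : (max_response s < rho%:E)%E ->
  forall r, exists k : tx s, serves k r /\ tx_finish k <= arrival r + rho.
Proof.
move=> s_rho r.
have : (response_time s r < rho%:E)%E.
  by apply: le_lt_trans s_rho; apply: ereal_sup_ubound; exists r.
rewrite /response_time lteBlDr// => /ereal_inf_lt[_ [k kr <-] lt_k].
by exists k; split => //; move: lt_k; rewrite -EFinD lte_fin addrC => /ltW.
Qed.

(** Once a request exists, the positivity of [rho] rules out a maximum response of [-oo]. *)
Lemma FIFO_response s (o : schedule I) (rho : R) r : is_FIFO s ->
  (max_response o < rho%:E)%E ->
  0 < rho /\ (response_time s r <= (2 * rho)%:E)%E.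
Proof.
move=> [nps idle /choice[x xE]] /max_response_lt/choice[y yE].
split; first exact: rho_gt0 yE r.
have [k [kr fk]] := FIFO_served nps idle xE yE r.
rewrite /response_time leeBlDr// -EFinD addrC.
apply: (@le_trans _ _ (tx_finish k)%:E); last by rewrite lee_fin.
by apply: ereal_inf_lbound; exists k.
Qed.

End BroadcastFIFO.

Theorem theorem1 (R : realType) (I : instance R) (s : schedule I)
    (hs : is_FIFO s) :
  (max_response s <= 2%:R%:E * opt_response I)%E.
Proof.
apply: ge_ereal_sup => _ [r _ <-].
rewrite -lee_pdivrMl//; apply: le_ereal_inf_tmp => _ [opt _ <-].
have bound := FIFO_response (o := opt) r hs.
case: (max_response opt) bound => [M||] bound; last 2 first.
- by rewrite leey.
- by have [] := bound 0%R (ltNyr _); rewrite ltxx.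
apply/lee_addgt0Pr => e e0; rewrite lee_pdivrMl// -EFinD -EFinM.
by have [] := bound (M + e)%R; rewrite // lte_fin ltrDl.
Qed.
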